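(* Let $\mathcal{U}$ be a finite non-empty set of $n$ nodes of a directed graph in which every node has at least one outgoing edge, let $\hat{\mathcal{M}}=\{\hat{\mathcal{D}}_1,\dots,\hat{\mathcal{D}}_K\}$ be an indexed family of non-empty subsets (blocks, possibly overlapping) of $\mathcal{U}$ with $\mathcal{U}=\bigcup_{k=1}^K\hat{\mathcal{D}}_k$, and let $\mathbf{H}$, $\hat{\mathbf{M}}=\hat{\mathbf{R}}\hat{\mathbf{A}}$ and $\mathbf{W}=\hat{\mathbf{A}}\hat{\mathbf{R}}$ be the associated hyperlink matrix, inter-level proximity matrix and indicator matrix. Let $\eta,\mu$ be positive real numbers with $\eta+\mu=1$. Then the matrix $\mathbf{P}=\eta\mathbf{H}+\mu\hat{\mathbf{M}}$ is primitive if and only if the indicator matrix $\mathbf{W}$ is irreducible.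
   Context: Irreducibility: a non-negative square matrix $\mathbf{T}$ is irreducible if for every pair of indices $i,j$ there is a positive integer $m=m(i,j)$ with $[\mathbf{T}^m]_{ij}>0$; otherwise it is reducible. The period of an index $i$ is the greatest common divisor of all positive integers $m$ with $[\mathbf{T}^m]_{ii}>0$; for an irreducible matrix all indices have the same period, called the period of the matrix. A matrix is primitive if it is irreducible with period $1$. Graph and hyperlink matrix: $\mathcal{U}=\{u_1,\dots,u_n\}$ is the node set of a directed graph. For a node $u$, $\mathcal{G}_u\subseteq\mathcal{U}$ is the set of nodes $v$ such that there is an edge from $u$ to $v$, and $d_u=|\mathcal{G}_u|$, assumed to be $\geq 1$ for every $u$. The hyperlink matrix $\mathbf{H}\in\mathbb{R}^{n\times n}$ has $[\mathbf{H}]_{uv}=1/d_u$ if $v\in\mathcal{G}_u$ and $0$ otherwise; it is row-stochastic. Overlapping decomposition: $\hat{\mathcal{D}}_1,\dots,\hat{\mathcal{D}}_K$ are non-empty subsets of $\mathcal{U}$ covering $\mathcal{U}$, not necessarily disjoint. The proximal set $\hat{\mathcal{M}}_u$ of a node $u$ is the union of all blocks $\hat{\mathcal{D}}_k$ that contain some $w\in\{u\}\cup\mathcal{G}_u$. One writes $\hat{\mathcal{D}}_k\in\hat{\mathcal{M}}_u$ when $\hat{\mathcal{D}}_k$ is one of the blocks in this union, i.e. when $\hat{\mathcal{D}}_k\cap(\{u\}\cup\mathcal{G}_u)\neq\emptyset$, and $N_u$ is the number of indices $k$ with $\hat{\mathcal{D}}_k\in\hat{\mathcal{M}}_u$. Matrices: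 the inter-level proximity matrix $\hat{\mathbf{M}}\in\mathbb{R}^{n\times n}$ has $[\hat{\mathbf{M}}]_{uv}=\sum_{k:\,\hat{\mathcal{D}}_k\in\hat{\mathcal{M}}_u,\ v\in\hat{\mathcal{D}}_k}\frac{1}{N_u|\hat{\mathcal{D}}_k|}$. Let $\mathbf{X}\in\mathbb{R}^{n\times K}$ have $[\mathbf{X}]_{ik}=1$ if $\hat{\mathcal{D}}_k\in\hat{\mathcal{M}}_{u_i}$ and $0$ otherwise, and let $\mathbf{Y}\in\mathbb{R}^{K\times n}$ have $[\mathbf{Y}]_{kj}=1$ if $u_j\in\hat{\mathcal{D}}_k$ and $0$ otherwise. Let $\hat{\mathbf{R}}$ and $\hat{\mathbf{A}}$ be the row-normalized versions of $\mathbf{X}$ and $\mathbf{Y}$ (each row divided by its sum). Then $\hat{\mathbf{M}}=\hat{\mathbf{R}}\hat{\mathbf{A}}$. The indicator matrix is $\mathbf{W}=\hat{\mathbf{A}}\hat{\mathbf{R}}\in\mathbb{R}^{K\times K}$. *)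

(* Defs.v *)
From mathcomp Require Import all_boot all_order all_algebra.
From mathcomp Require Import reals.

Set Implicit Arguments.
Unset Strict Implicit.
Unset Printing Implicit Defensive.

Import Order.TTheory GRing.Theory Num.Theory.
Local Open Scope ring_scope.

Definition nonneg_mx (R : realType) (n : nat) (T : 'M[R]_n) : Prop :=
  forall i j, 0 <= T i j.

Definition irreducible_mx (R : realType) (n : nat) (T : 'M[R]_n) : Prop :=
  nonneg_mx T /\
  forall i j, exists m : nat, (0 < m)%N /\ 0 < (T ^+ m) i j.

(** [d] is the gcd, for divisibility, of the possibly infinite set of positive
    [m] with a positive entry [(T ^+ m) i i]. Such a [d] is unique; it is [0]
    when there is no such [m], which cannot happen for irreducible [T]. *)
Definition index_period (R : realType) (n : nat) (T : 'M[R]_n) (i : 'I_n)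
    (d : nat) : Prop :=
  (forall m : nat, (0 < m)%N -> 0 < (T ^+ m) i i -> (d %| m)%N) /\
  (forall c : nat,
     (forall m : nat, (0 < m)%N -> 0 < (T ^+ m) i i -> (c %| m)%N) ->
     (c %| d)%N).

Definition mx_period (R : realType) (n : nat) (T : 'M[R]_n) (d : nat) : Prop :=
  forall i, index_period T i d.

Definition primitive_mx (R : realType) (n : nat) (T : 'M[R]_n) : Prop :=
  irreducible_mx T /\ mx_period T 1.

(** The node set is ['I_n] and [e u v] means that there is an edge from [u]
    to [v]; self-loops are allowed. *)

Definition out_nbrs (n : nat) (e : rel 'I_n) (u : 'I_n) : {set 'I_n} :=
  [set v | e u v].

Definition hyperlink_mx (R : realType) (n : nat) (e : rel 'I_n) : 'M[R]_n :=
  \matrix_(u, v)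
    (if v \in out_nbrs e u then 1 / #|out_nbrs e u|%:R else 0).

(** The blocks are an indexed family [D : 'I_K -> {set 'I_n}], so that the same
    set may occur under several indices and is then counted once per index. *)

(** [D k] is one of the blocks whose union is the proximal set of [u]. *)
Definition proximal (n K : nat) (e : rel 'I_n) (D : 'I_K -> {set 'I_n})
    (u : 'I_n) (k : 'I_K) : bool :=
  D k :&: (u |: out_nbrs e u) != set0.

Definition nb_proximal (n K : nat) (e : rel 'I_n) (D : 'I_K -> {set 'I_n})
    (u : 'I_n) : nat :=
  #|[set k | proximal e D u k]|.

Definition proximity_mx (R : realType) (n K : nat) (e : rel 'I_n)
    (D : 'I_K -> {set 'I_n}) : 'M[R]_n :=
  \matrix_(u, v)
    \sum_(k < K | proximal e D u k && (v \in D k))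
      1 / ((nb_proximal e D u)%:R * #|D k|%:R).

Definition row_normalize (R : realType) (m n : nat) (A : 'M[R]_(m, n)) :
    'M[R]_(m, n) :=
  \matrix_(i, j) (A i j / \sum_(l < n) A i l).

Definition X_mx (R : realType) (n K : nat) (e : rel 'I_n)
    (D : 'I_K -> {set 'I_n}) : 'M[R]_(n, K) :=
  \matrix_(i, k) (if proximal e D i k then 1 else 0).

Definition Y_mx (R : realType) (n K : nat) (D : 'I_K -> {set 'I_n}) :
    'M[R]_(K, n) :=
  \matrix_(k, j) (if j \in D k then 1 else 0).

Definition R_mx (R : realType) (n K : nat) (e : rel 'I_n)
    (D : 'I_K -> {set 'I_n}) : 'M[R]_(n, K) :=
  row_normalize (X_mx R e D).

Definition A_mx (R : realType) (n K : nat) (D : 'I_K -> {set 'I_n}) :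
    'M[R]_(K, n) :=
  row_normalize (Y_mx R D).

Definition indicator_mx (R : realType) (n K : nat) (e : rel 'I_n)
    (D : 'I_K -> {set 'I_n}) : 'M[R]_K :=
  A_mx R D *m R_mx R e D.

(* Main.v *)
(** Since the blocks cover the nodes, [P u v] is positive exactly when [v] lies
    in some block proximal to [u]: the edges of [H] add nothing to the support
    of [M = R A].  In particular the diagonal of [P] is positive, so only
    irreducibility matters, and it depends only on the support.  Finally
    [(R A)^(m+1) = R (A R)^m A] transfers irreducibility between [R A] and
    [A R], as neither factor has a zero row or a zero column. *)
Require Import Defs.
From mathcomp Require Import all_boot all_order all_algebra.
From mathcomp Require Import reals.
Import Order.TTheory GRing.Theory Num.Theory.
Local Open Scope ring_scope.

Section Support.
Context {R : realType}.

Lemma mulmx_ge0 {m n p} (A : 'M[R]_(m, n)) (B : 'M[R]_(n, p)) :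
  (forall i j, 0 <= A i j) -> (forall i j, 0 <= B i j) ->
  forall i j, 0 <= (A *m B) i j.
Proof. by move=> A0 B0 i j; rewrite mxE sumr_ge0 // => k _; apply: mulr_ge0. Qed.

(** Non-negative terms cannot cancel, so their sum is nonzero exactly when one term is. Hence the
    support of a product is the boolean product of the supports. *)
Lemma mulmx_gt0 {m n p} (A : 'M[R]_(m, n)) (B : 'M[R]_(n, p)) i j :
  (forall i j, 0 <= A i j) -> (forall i j, 0 <= B i j) ->
  (0 < (A *m B) i j) = [exists k, (0 < A i k) && (0 < B k j)].
Proof.
move=> A0 B0; rewrite lt0r mulmx_ge0 // andbT mxE psumr_neq0 => [|k _].
  apply/hasP/existsP => [[k _ /= ABk]|[k /andP[Ak Bk]]]; exists k.
  - have /andP[nzA nzB] : (A i k != 0) && (B k j != 0).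
      by rewrite -negb_or -mulf_eq0 lt0r_neq0.
    by rewrite !lt0r nzA nzB A0 B0.
  - by rewrite mem_index_enum.
  - by rewrite /= mulr_gt0.
exact: mulr_ge0.
Qed.

Lemma exprmx_ge0 {n} (T : 'M[R]_n) m : nonneg_mx T -> nonneg_mx (T ^+ m).
Proof.
move=> T0; elim: m => [|m IHm]; first by move=> i j; rewrite expr0 mxE ler0n.
by rewrite exprS; apply: mulmx_ge0.
Qed.

Lemma exprmx_gt0_support {n} (S T : 'M[R]_n) m i j :
    nonneg_mx S -> nonneg_mx T ->
    (forall i j, (0 < S i j) = (0 < T i j)) ->
  (0 < (S ^+ m) i j) = (0 < (T ^+ m) i j).
Proof.
move=> S0 T0 ST; elim: m i j => [|m IHm] i j; first by rewrite !expr0.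
rewrite !exprS !mulmx_gt0 //; try exact: exprmx_ge0.
by apply: eq_existsb => k; rewrite ST IHm.
Qed.

Lemma irreducible_mx_support {n} (S T : 'M[R]_n) :
    nonneg_mx S -> nonneg_mx T ->
    (forall i j, (0 < S i j) = (0 < T i j)) ->
  irreducible_mx S -> irreducible_mx T.
Proof.
move=> S0 T0 ST [_ irrS]; split=> // i j.
have [m [m0 Sm]] := irrS i j.
by exists m; rewrite -(exprmx_gt0_support _ _ _ _ _ S0 T0 ST).
Qed.

Lemma exprmx_mulC {n p} (A : 'M[R]_(n, p)) (B : 'M[R]_(p, n)) m :
  (A *m B) ^+ m.+1 = A *m (B *m A) ^+ m *m B.
Proof.
elim: m => [|m IHm]; first by rewrite expr1 expr0 mulmx1.
rewrite exprS IHm exprS.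
(* The ring product coming from [exprS] is restated as [*m], so that [mulmxA] can reassociate it. *)
change (A *m B *m (A *m (B *m A) ^+ m *m B) =
        A *m (B *m A *m (B *m A) ^+ m) *m B).
by rewrite !mulmxA.
Qed.

(** A walk from [i] to [j] is glued from a step [i -> k] of [A], a walk [k -> l] of [B *m A] of
    length [m], and a step [l -> j] of [B]. *)
Lemma irreducible_mx_mulC {n p} (A : 'M[R]_(n, p)) (B : 'M[R]_(p, n)) :
    (forall i k, 0 <= A i k) -> (forall k j, 0 <= B k j) ->
    (forall i, exists k, 0 < A i k) -> (forall j, exists k, 0 < B k j) ->
  irreducible_mx (B *m A) -> irreducible_mx (A *m B).
Proof.
move=> A0 B0 rowA colB [BA0 irr]; split; first exact: mulmx_ge0.
move=> i j; have [k Aik] := rowA i; have [l Blj] := colB j.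
have [m [_ BAm]] := irr k l; exists m.+1; split=> //.
have BAm0 := exprmx_ge0 _ m BA0.
rewrite exprmx_mulC mulmx_gt0 //; last exact: mulmx_ge0.
apply/existsP; exists l; rewrite Blj andbT mulmx_gt0 //.
by apply/existsP; exists k; rewrite Aik.
Qed.

(** The exponent 1 is itself a return time, so every common divisor of the return times divides
    1. *)
Lemma mx_period1 {n} (T : 'M[R]_n) : (forall i, 0 < T i i) -> mx_period T 1.
Proof.
move=> T0 i; split=> [m _ _|c]; first exact: dvd1n.
by apply=> //; rewrite expr1.
Qed.

Lemma row_normalize_ge0 {m n} (A : 'M[R]_(m, n)) :
  (forall i j, 0 <= A i j) -> forall i j, 0 <= row_normalize A i j.
Proof. by move=> A0 i j; rewrite mxE divr_ge0 // sumr_ge0. Qed.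

Lemma row_normalize_gt0 {m n} (A : 'M[R]_(m, n)) i j :
  (forall i j, 0 <= A i j) -> (0 < row_normalize A i j) = (0 < A i j).
Proof.
move=> A0; rewrite mxE; have [Aij|] := ltrP 0 (A i j).
  by rewrite divr_gt0 // (bigD1 j) //= ltr_wpDr // sumr_ge0.
(* Here [A i j = 0], so the quotient is 0 whatever the row sum, even a zero one. *)
by move=> Aij; rewrite (@le_anti _ _ (A i j) 0) ?Aij ?A0 // mul0r ltxx.
Qed.

End Support.

Section Proximity.
Context {R : realType} {n K : nat} (e : rel 'I_n) (D : 'I_K -> {set 'I_n}).

Lemma R_mx_ge0 u k : 0 <= R_mx R e D u k.
Proof. by apply: row_normalize_ge0 => i j; rewrite mxE; case: ifP. Qed.

Lemma A_mx_ge0 k u : 0 <= A_mx R D k u.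
Proof. by apply: row_normalize_ge0 => i j; rewrite mxE; case: ifP. Qed.

Lemma R_mx_gt0 u k : (0 < R_mx R e D u k) = proximal e D u k.
Proof.
rewrite row_normalize_gt0 => [|i j]; rewrite mxE; case: ifP => // _.
by rewrite ltr01.
Qed.

Lemma A_mx_gt0 k u : (0 < A_mx R D k u) = (u \in D k).
Proof.
rewrite row_normalize_gt0 => [|i j]; rewrite mxE; case: ifP => // _.
by rewrite ltr01.
Qed.

Lemma hyperlink_mx_ge0 : nonneg_mx (hyperlink_mx R e).
Proof. by move=> u v; rewrite mxE; case: ifP => // _; rewrite divr_ge0 ?ler0n. Qed.

Lemma hyperlink_mx_gt0 u v : 0 < hyperlink_mx R e u v -> e u v.
Proof. by rewrite mxE inE; case: ifP => //; rewrite ltxx. Qed.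

(** The row sums of [X_mx] and [Y_mx] are [nb_proximal e D u] and [#|D k|], after which the two sums
    over [k] agree term by term. *)
Lemma proximity_mxE : proximity_mx R e D = R_mx R e D *m A_mx R D.
Proof.
apply/matrixP=> u v; rewrite !mxE big_mkcond; apply: eq_bigr => k _.
have sumX : \sum_l X_mx R e D u l = (nb_proximal e D u)%:R.
  rewrite /nb_proximal -sum1_card natr_sum [RHS]big_mkcond.
  by apply: eq_bigr => l _; rewrite mxE inE.
have sumY : \sum_l Y_mx R D k l = #|D k|%:R.
  rewrite -sum1_card natr_sum [RHS]big_mkcond.
  by apply: eq_bigr => l _; rewrite mxE.
rewrite !mxE sumX sumY; case: (proximal e D u k); last by rewrite !mul0r.
by case: (v \in D k); rewrite /= ?mul0r ?mulr0 // !mul1r invfM.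
Qed.

Lemma proximal_mem u v k : (v == u) || e u v -> v \in D k -> proximal e D u k.
Proof.
by move=> uv vk; apply/set0Pn; exists v; rewrite !inE vk.
Qed.

Hypothesis D_cover : \bigcup_(k < K) D k = [set: 'I_n].

Lemma block_mem u : exists k, u \in D k.
Proof.
have /bigcupP[k _ uk] : u \in \bigcup_(k < K) D k by rewrite D_cover inE.
by exists k.
Qed.

(** Any block containing [v] meets [u |: out_nbrs e u] at [v], hence is proximal to [u]; the
    covering supplies such a block. *)
Lemma proximity_mx_gt0 u v : (v == u) || e u v -> 0 < proximity_mx R e D u v.
Proof.
move=> uv; have [k vk] := block_mem v.
rewrite proximity_mxE mulmx_gt0; [|exact: R_mx_ge0|exact: A_mx_ge0].
by apply/existsP; exists k; rewrite R_mx_gt0 A_mx_gt0 vk (proximal_mem _ v).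
Qed.

End Proximity.

Theorem mainTheorem2 (R : realType) (n K : nat) (e : rel 'I_n)
    (D : 'I_K -> {set 'I_n}) (eta mu : R)
    (n_gt0 : (0 < n)%N)
    (out_deg : forall u : 'I_n, (1 <= #|out_nbrs e u|)%N)
    (D_nonempty : forall k : 'I_K, D k != set0)
    (D_cover : \bigcup_(k < K) D k = [set: 'I_n])
    (eta_gt0 : 0 < eta) (mu_gt0 : 0 < mu) (eta_mu : eta + mu = 1) :
  primitive_mx (eta *: hyperlink_mx R e + mu *: proximity_mx R e D)
  <-> irreducible_mx (indicator_mx R e D).
Proof.
set P := eta *: _ + _; set M := proximity_mx R e D.
have R0 := @R_mx_ge0 R n K e D; have A0 := @A_mx_ge0 R n K D.
have H0 := @hyperlink_mx_ge0 R n e.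
have M0 : nonneg_mx M by rewrite /M proximity_mxE; apply: mulmx_ge0.
have PE u v : P u v = eta * hyperlink_mx R e u v + mu * M u v by rewrite !mxE.
have P0 : nonneg_mx P by move=> u v; rewrite PE addr_ge0 // mulr_ge0 // ltW.
have PM u v : (0 < P u v) = (0 < M u v).
  have [Muv|Muv] := ltrP 0 (M u v).
    by rewrite PE ltr_wpDl ?mulr_gt0 // mulr_ge0 // ltW.
  (* An edge from [u] to [v] would make [M u v] positive, so both summands of [P u v] are at most
     0. *)
  have [/hyperlink_mx_gt0 uv|Huv] := ltrP 0 (hyperlink_mx R e u v).
    by move: Muv; rewrite leNgt proximity_mx_gt0 // uv orbT.
  by apply/negbTE; rewrite -leNgt PE -[leRHS]addr0 lerD // pmulr_rle0.
have diagP u : 0 < P u u by rewrite PM proximity_mx_gt0 // eqxx.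
have block_prox u k : u \in D k -> proximal e D u k.
  by apply: proximal_mem; rewrite eqxx.
have blockP k : exists u, u \in D k by apply/set0Pn.
split=> [[irrP _]|irrW].
  have := irreducible_mx_support _ _ P0 M0 PM irrP.
  rewrite /M proximity_mxE; apply: irreducible_mx_mulC => // k.
    (* A member [u] of the non-empty block [k] gives a positive entry in row [k] of [A_mx] and in
       column [k] of [R_mx]. *)
    by have [u uk] := blockP k; exists u; rewrite A_mx_gt0.
  by have [u uk] := blockP k; exists u; rewrite R_mx_gt0 block_prox.
split; last exact: mx_period1.
apply: (irreducible_mx_support _ _ M0 P0) => [u v|]; first by rewrite PM.
rewrite /M proximity_mxE; apply: irreducible_mx_mulC => // u.
  (* With the roles exchanged, a block covering [u] serves row [u] of [R_mx] and column [u] of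
     [A_mx]. *)
  by have [k uk] := block_mem D D_cover u; exists k; rewrite R_mx_gt0 block_prox.
by have [k uk] := block_mem D D_cover u; exists k; rewrite A_mx_gt0.
Qed.
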